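(* Let $W=\langle w_1,w_2,w_3\rangle$ be a $\mathbb{Z}_2$-graded complex vector space with $w_1$ odd and $w_2,w_3$ even. Let $m>2$ be an integer, $c=1/m$, and let $$d_c=\psi^{1,1,0}_2+c\,\psi^{1,0,1}_3 .$$ Then every nontrivial extension of $d_c$ (an extension not equivalent to $d_c$) is equivalent to $$d_e=\psi^{1,1,0}_2+c\,\psi^{1,0,1}_3+\psi^{1,0,m}_2,$$ and every extension of $d_e$ (that is, every codifferential of the form $d_e+\sum_{l>m+1}d_l$ with $d_l\in L_l$) is equivalent to $d_e$.
   Context: $S(W)=\bigoplus_{n\ge 1}S^n(W)$ is the ($\mathbb{Z}_2$-graded) symmetric coalgebra of $W$. Put $L_n=\mathrm{Hom}(S^n(W),W)$ and $L=\mathrm{Hom}(S(W),W)=\prod_{n\ge1}L_n$, identified with the space $\mathrm{Coder}(S(W))$ of coderivations of $S(W)$, a $\mathbb{Z}_2$-graded Lie algebra under the graded commutator $[\cdot,\cdot]$ of coderivations. Elements of $L_n$ have degree $n$. A codifferential is an odd element $d=d_1+d_2+\cdots\in L$, $d_i\in L_i$, with $[d,d]=0$. Its leading term is its first nonvanishing component $d_N$, and $d$ is then called an extension of $d_N$. For a multi-index $I=(i_1,i_2,i_3)$ with $i_1\in\{0,1\}$ and $i_2,i_3\ge 0$ let $w_I=w_1^{i_1}w_2^{i_2}w_3^{i_3}$, $|I|=i_1+i_2+i_3$, $I!=i_1!\,i_2!\,i_3!$. For $|I|=n$ define $\varphi^I_j\in L_n$ by $\varphi^I_j(w_J)=I!\,\delta^I_J\,w_j$.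 When $\varphi^I_j$ is odd it is written $\psi^I_j$. A coalgebra automorphism $g$ of $S(W)$ is determined by an even element $g_1+g_2+\cdots$ of $\mathrm{Hom}(S(W),W)$ with $g_i\in\mathrm{Hom}(S^i(W),W)$ and $g_1:W\to W$ invertible. Two codifferentials $d,d'$ are equivalent if $d'=g^*(d):=g^{-1}dg$ for some coalgebra automorphism $g$ of $S(W)$. *)

(* Defs.v *)
From HB Require Import structures.
From mathcomp Require Import all_boot all_order all_algebra.
From mathcomp Require Import finmap.
From mathcomp Require Import monalg.
From mathcomp Require Import reals.
From mathcomp Require Import complex.

Set Implicit Arguments.
Unset Strict Implicit.
Unset Printing Implicit Defensive.

Import GRing.Theory.
Local Open Scope ring_scope.

(* Exponents (i_1, i_2, i_3) of w_1^i_1 w_2^i_2 w_3^i_3.  Since w_1 is odd,   *)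
(* w_1^2 = 0, and S(W) starts in degree 1, the monomials w_I that form a      *)
(* basis of S(W) are those with i_1 <= 1 and |I| >= 1.                        *)
Notation mindex := (nat * nat * nat)%type.
Definition mdegree (I : mindex) : nat := (I.1.1 + I.1.2 + I.2)%N.
Definition mfact (I : mindex) : nat := (I.1.1`! * I.1.2`! * I.2`!)%N.
Definition mbinom (I J : mindex) : nat :=
  ('C(I.1.1, J.1.1) * 'C(I.1.2, J.1.2) * 'C(I.2, J.2))%N.
Definition madd (I J : mindex) : mindex :=
  (I.1.1 + J.1.1, I.1.2 + J.1.2, I.2 + J.2)%N.
Definition msub (I J : mindex) : mindex :=
  (I.1.1 - J.1.1, I.1.2 - J.1.2, I.2 - J.2)%N.
Definition mbelow (I : mindex) : seq mindex :=
  [seq (p, c) | p <- [seq (a, b) | a <- iota 0 I.1.1.+1, b <- iota 0 I.1.2.+1],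
                c <- iota 0 I.2.+1].
Definition munit (j : 'I_3) : mindex :=
  ((j == 0%N :> nat) : nat, (j == 1%N :> nat) : nat, (j == 2%N :> nat) : nat).

Definition is_mon (I : mindex) : bool := (I.1.1 <= 1)%N && (0 < mdegree I)%N.
Notation mon := {I : mindex | is_mon I}.

Lemma munit_is_mon (j : 'I_3) : is_mon (munit j).
Proof. by case: j => [[|[|[|]]]]. Qed.
Definition mgen (j : 'I_3) : mon := Sub (munit j) (munit_is_mon j).

Definition modd (I : mindex) : bool := odd I.1.1.
Definition godd (j : 'I_3) : bool := j == 0%N :> nat.

(* The generators w_1, w_2, w_3 of W are indexed by 0, 1, 2 : 'I_3. *)
Definition i1 : 'I_3 := @Ordinal 3 0 isT.
Definition i2 : 'I_3 := @Ordinal 3 1 isT.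
Definition i3 : 'I_3 := @Ordinal 3 2 isT.

(* W, S(W) and S(W) (x) S(W). *)
Notation Wsp K := 'rV[K]_3.
Notation SymW K := {malg K[mon]}.
Notation SymW2 K := {malg K[(mon * mon)%type]}.

Section SymmetricCoalgebra.
Variable K : fieldType.

Local Notation W := (Wsp K).
Local Notation SW := (SymW K).
Local Notation SW2 := (SymW2 K).

Definition gen (j : 'I_3) : W := delta_mx 0 j.

Section LinearExtension.
Variables (T : choiceType) (V : lmodType K) (f : T -> V).

Definition linext (x : {malg K[T]}) : V := \sum_(t <- msupp x) x@_t *: f t.

Lemma linextEw (d : {fset T}) (x : {malg K[T]}) :
  fsubset (msupp x) d -> linext x = \sum_(t <- d) x@_t *: f t.
Proof.
move=> le; rewrite /linext (big_fset_incl _ le) // => t _ /mcoeff_outdom ->.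
by rewrite scale0r.
Qed.

Lemma linext_is_linear : linear linext.
Proof.
move=> a x y; pose d := fsetU (msupp x) (msupp y).
have lex : fsubset (msupp x) d by apply: fsubsetUl.
have ley : fsubset (msupp y) d by apply: fsubsetUr.
have le : fsubset (msupp (a *: x + y)) d.
  apply: (fsubset_trans (msuppD_le _ _)); apply: fsetUSS => //.
  exact: msuppZ_le.
rewrite (linextEw le) (linextEw lex) (linextEw ley) scaler_sumr -big_split /=.
by apply: eq_bigr => t _; rewrite mcoeffD mcoeffZ scalerDl scalerA.
Qed.

HB.instance Definition _ :=
  GRing.isLinear.Build K {malg K[T]} V *:%R linext linext_is_linear.

Lemma linextU t : linext << t >> = f t.
Proof. by rewrite /linext msuppU oner_eq0 big_seq_fset1 mcoeffUU scale1r. Qed.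
End LinearExtension.

(* w_I, with the conventions w_I = 0 if i_1 >= 2, and w_0 = 0 (S(W) does not  *)
(* contain S^0(W)).                                                           *)
Definition w (I : mindex) : SW := oapp (fun J : mon => << J >>) 0 (insub I).

Definition tens (x y : SW) : SW2 :=
  \sum_(I <- msupp x) \sum_(J <- msupp y) << x@_I * y@_J *g (I, J) >>.

(* As w_1 is the only odd generator and stands first in w_I, unshuffling w_I  *)
(* into w_J (x) w_(I-J) never produces a sign; the terms J = 0 and J = I      *)
(* vanish because w_0 = 0.                                                    *)
Definition Delta : SW -> SW2 :=
  linext (fun I : mon =>
    \sum_(J <- mbelow (val I))
       (mbinom (val I) J)%:R *: tens (w J) (w (msub (val I) J))).

(* (f (x) g)(x (x) y) = (-1)^(|g||x|) f x (x) g y, where p is the parity of g. *)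
Definition tensmap (p : bool) (f g : SW -> SW) : SW2 -> SW2 :=
  linext (fun IJ : mon * mon =>
    (-1) ^+ (p && modd (val IJ.1)) *: tens (f << IJ.1 >>) (g << IJ.2 >>)).

(* Homogeneity of parity p (true = odd). *)
Definition homS (p : bool) (f : SW -> SW) : Prop :=
  forall I J : mon, (f << I >>)@_J != 0 -> modd (val J) = modd (val I) (+) p.
Definition homL (p : bool) (f : SW -> W) : Prop :=
  forall (I : mon) (j : 'I_3), (f << I >>) 0 j != 0 -> godd j = modd (val I) (+) p.

Definition coderivation (p : bool) (D : SW -> SW) : Prop :=
  homS p D /\
  forall x, Delta (D x) = tensmap false D idfun (Delta x)
                        + tensmap p idfun D (Delta x).

Definition corestr (f : SW -> SW) (x : SW) : W := \row_j (f x)@_(mgen j).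

(* The coderivation whose corestriction is phi : S(W) -> W, that is           *)
(*   w_I |-> \sum_J (I choose J) phi(w_J) w_(I-J),                            *)
(* in which the term J = I is phi(w_I) : W = S^1(W).  No sign occurs, as      *)
(* above, and w_j w_K = w_(K + e_j).                                          *)
Definition mulW (v : W) (I : mindex) : SW :=
  \sum_(j < 3) v 0 j *: w (madd (munit j) I).
Definition coder (phi : SW -> W) : SW -> SW :=
  linext (fun I : mon =>
    \sum_(J <- mbelow (val I))
       (mbinom (val I) J)%:R *: mulW (phi (w J)) (msub (val I) J)).

Definition gbracket (p q : bool) (D E : SW -> SW) : SW -> SW :=
  fun x => D (E x) - (-1) ^+ (p && q) *: E (D x).

(* L = Hom(S(W), W) is {linear SW -> W}. *)
Definition codifferential (d : {linear SW -> W}) : Prop :=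
  homL true d /\ forall x, gbracket true true (coder d) (coder d) x = 0.

(* The component d_n in L_n = Hom(SW^n(W), W), extended by 0. *)
Definition component (n : nat) (d : {linear SW -> W}) : SW -> W :=
  linext (fun I : mon => if mdegree (val I) == n then d << I >> else 0).

Definition leading_term (d dN : {linear SW -> W}) : Prop :=
  exists N : nat,
    [/\ forall n, (n < N)%N -> component n d =1 (fun=> 0),
        component N d =1 dN & ~ (dN =1 (fun=> 0))].

Definition extension (dN d : {linear SW -> W}) : Prop :=
  codifferential d /\ leading_term d dN.

(* d is a codifferential of the form d0 + \sum_(l > N) d_l with d_l in L_l. *)
Definition higher_extension (N : nat) (d0 d : {linear SW -> W}) : Prop :=
  codifferential d /\
  forall n, (n <= N)%N -> component n d =1 component n d0.

Definition coalgebra_automorphism (g h : {linear SW -> SW}) : Prop :=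
  [/\ cancel g h, cancel h g, homS false g &
      forall x, Delta (g x) = tensmap false g g (Delta x)].

(* d' = g^* d = g^-1 d g; h is the inverse of g. *)
Definition equivalent (d d' : {linear SW -> W}) : Prop :=
  exists g h : {linear SW -> SW},
    coalgebra_automorphism g h /\
    forall x, coder d' x = h (coder d (g x)).

Definition phi (I : mindex) (j : 'I_3) : {linear SW -> W} :=
  linext (fun J : mon => if val J == I then (mfact I)%:R *: gen j else 0).

Definition d_c (c : K) : {linear SW -> W} :=
  phi (1, 1, 0)%N i2 \+ c \*: phi (1, 0, 1)%N i3.

Definition d_e (c : K) (m : nat) : {linear SW -> W} :=
  d_c c \+ phi (1, 0, m)%N i2.

End SymmetricCoalgebra.

(* Main.v *)
From HB Require Import structures.
Require Import Defs.
From mathcomp Require Import all_boot all_order all_algebra.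
From mathcomp Require Import finmap monalg reals complex.
From mathcomp Require Import boolp ring zify.

(* An odd codifferential on S(W) is dual to an odd vector field
   xi (A dx + B dy) + E dxi on the formal super space with coordinates xi (odd)
   and x, y (even), where A, B, E are power series in x and y.  Its square
   vanishes only if E A = 0, so an extension of d_c has E = 0 and is the vector
   field v = A dx + B dy with linear part x dx + (y / m) dy.  The eigenvalue
   p + q / m of x^p y^q resonates with 1 and 1 / m only through x, y^m and y,
   so a fixed point argument (Poincare-Dulac) yields series X = x + ... and
   Y = y + ... with v Y = Y / m and v X = X + a Y^m.  The substitution
   x := X, y := Y is dual to a coalgebra automorphism conjugating d to d_c if
   a = 0, and to d_e after rescaling X by 1 / a otherwise. *)

(** The weights [p! q!] in the pairing of series with S(W) absorb the binomial coefficients of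
    [Delta] and [coder]: the comultiplication becomes dual to the plain product of series and a
    coderivation to a derivation. In characteristic 0 these weights are invertible, so identities in
    S(W) can be checked on monomials. As S(W) starts in degree 1, constant terms are invisible and
    have to be controlled separately. A substitution is needed only through the images [X^a Y^b] of
    monomials. Its transpose never raises the degree and is invertible on the diagonal, so it acts
    on finite combinations and is inverted by induction on the degree. The resonance at [y^m] is the
    obstacle: there the equation for the coefficient of [X] degenerates, and [a] is forced instead
    of chosen. For an extension of d_e it is forced to be 1, because the added terms change the
    coefficients of v only in order m + 1 and above, too late to reach [y^m]. *)

Set Implicit Arguments.
Unset Strict Implicit.
Unset Printing Implicit Defensive.

Import GRing.Theory.
Local Open Scope ring_scope.

(** * Formal power series in one variable *)

Definition fps (R : comNzRingType) : Type := nat -> R.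

Section FpsRing.
Variable R : comNzRingType.
Implicit Types f g h : fps R.

HB.instance Definition _ := gen_eqMixin (fps R).
HB.instance Definition _ := gen_choiceMixin (fps R).

Definition fps_zero : fps R := fun=> 0.
Definition fps_opp f : fps R := fun n => - f n.
Definition fps_add f g : fps R := fun n => f n + g n.
Definition fps_one : fps R := fun n => (n == 0%N)%:R.
Definition fps_mul f g : fps R := fun n => \sum_(i < n.+1) f i * g (n - i)%N.

Lemma fpsP f g : (forall n, f n = g n) -> f = g.
Proof. exact: funext. Qed.

Lemma fps_addA : associative fps_add.
Proof. by move=> f g h; apply: fpsP => n; apply: addrA. Qed.
Lemma fps_addC : commutative fps_add.
Proof. by move=> f g; apply: fpsP => n; apply: addrC. Qed.
Lemma fps_add0 : left_id fps_zero fps_add.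
Proof. by move=> f; apply: fpsP => n; apply: add0r. Qed.
Lemma fps_addN : left_inverse fps_zero fps_opp fps_add.
Proof. by move=> f; apply: fpsP => n; apply: addNr. Qed.

HB.instance Definition _ :=
  GRing.isZmodule.Build (fps R) fps_addA fps_addC fps_add0 fps_addN.

Definition fps_trunc (n : nat) f : {poly R} := \poly_(i < n.+1) f i.

(** A coefficient of a product involves finitely many coefficients of the factors, so commutativity
    and associativity are inherited from [{poly R}]. *)
Lemma fps_mul_trunc N f g n : (n <= N)%N ->
  fps_mul f g n = (fps_trunc N f * fps_trunc N g)`_n.
Proof.
move=> le_nN; rewrite coefM; apply: eq_bigr => i _; rewrite !coef_poly.
by rewrite !ltnS (leq_trans (leq_ord i) le_nN) (leq_trans (leq_subr _ _) le_nN).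
Qed.

Lemma fps_mulC : commutative fps_mul.
Proof. by move=> f g; apply: fpsP => n; rewrite !(fps_mul_trunc _ _ (leqnn n)) mulrC. Qed.

Lemma fps_mulA : associative fps_mul.
Proof.
have E f g h n :
    fps_mul (fps_mul f g) h n = (fps_trunc n f * fps_trunc n g * fps_trunc n h)`_n.
  rewrite (fps_mul_trunc _ _ (leqnn n)) !coefM; apply: eq_bigr => i _.
  by rewrite coef_poly ltnS leq_ord (fps_mul_trunc _ _ (leq_ord i)).
move=> f g h; apply: fpsP => n.
by rewrite fps_mulC !E mulrC mulrA.
Qed.

Lemma fps_mul1 : left_id fps_one fps_mul.
Proof.
move=> f; apply: fpsP => n; rewrite /fps_mul big_ord_recl /fps_one /= mul1r subn0.
by rewrite big1 ?addr0 // => i _; rewrite mul0r.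
Qed.

Lemma fps_mulD : left_distributive fps_mul fps_add.
Proof.
move=> f g h; apply: fpsP => n; rewrite /fps_add /fps_mul -big_split /=.
by apply: eq_bigr => i _; rewrite mulrDl.
Qed.

Lemma fps_one_neq0 : fps_one != fps_zero.
Proof. by apply/eqP => /(congr1 (fun f : fps R => f 0%N)) /eqP; rewrite oner_eq0. Qed.

HB.instance Definition _ := GRing.Zmodule_isComNzRing.Build (fps R)
  fps_mulA fps_mulC fps_mul1 fps_mulD fps_one_neq0.

Lemma fpsDE f g n : (f + g) n = f n + g n. Proof. by []. Qed.
Lemma fpsNE f n : (- f) n = - f n. Proof. by []. Qed.
Lemma fpsME f g n : (f * g) n = \sum_(i < n.+1) f i * g (n - i)%N. Proof. by []. Qed.
Lemma fps1E n : (1 : fps R) n = (n == 0%N)%:R. Proof. by []. Qed.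
Lemma fps0E n : (0 : fps R) n = 0. Proof. by []. Qed.
Lemma fps_sumE I (r : seq I) (P : pred I) (F : I -> fps R) n :
  (\sum_(i <- r | P i) F i) n = \sum_(i <- r | P i) F i n.
Proof. by apply: (big_morph (fun f : fps R => f n)). Qed.

Lemma fps_mulrnE f k n : (f *+ k) n = f n *+ k.
Proof. by elim: k => // k IH; rewrite !mulrS fpsDE IH. Qed.

(** If [i] and [j] are the orders of [f] and [g], the coefficient of [f * g] at [i + j] is the
    single product [f i * g j]. The absence of zero divisors is a plain hypothesis on [R], so the
    lemma can be iterated to reach two variables. *)
Lemma fps_mul_eq0 :
  (forall a b : R, a * b = 0 -> a = 0 \/ b = 0) ->
  forall f g, f * g = 0 -> f = 0 \/ g = 0.
Proof.
move=> domR f g fg0; apply: contrapT => /not_orP[f0 g0].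
have ex_coef (e : fps R) : e <> 0 -> exists n, e n != 0.
  move=> e0; apply: contrapT => /forallNP e_n; apply: e0; apply: fpsP => n.
  by apply/eqP/negPn/negP/e_n.
case: (ex_minnP (ex_coef f f0)) => i fi min_i.
case: (ex_minnP (ex_coef g g0)) => j gj min_j.
have /(congr1 (fun e : fps R => e (i + j)%N)) := fg0.
rewrite fpsME (bigD1 (Ordinal (leq_addr j i : i < (i + j).+1)%N)) //= addKn.
rewrite big1 ?addr0 => [/domR [|] /eqP|k]; [exact/negP|exact/negP|].
rewrite -val_eqE /= neq_ltn => /orP[lt_ki|lt_ik].
  have /eqP -> : f k == 0; last by rewrite mul0r.
  by apply: contraLR lt_ki => /min_i; rewrite -leqNgt.
have lt_j : (i + j - k < j)%N.
  by rewrite ltn_subLR ?(leq_ord k) // ltn_add2r.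
have /eqP -> : g (i + j - k)%N == 0; last by rewrite mulr0.
by apply: contraLR lt_j => /min_j; rewrite -leqNgt.
Qed.

Definition fps_deriv f : fps R := fun n => f n.+1 *+ n.+1.

Lemma fps_derivD : {morph fps_deriv : f g / f + g}.
Proof. by move=> f g; apply: fpsP => n; apply: mulrnDl. Qed.

Lemma fps_derivM f g : fps_deriv (f * g) = fps_deriv f * g + f * fps_deriv g.
Proof.
apply: fpsP => n; rewrite /fps_deriv fpsDE !fpsME -sumrMnl.
transitivity (\sum_(i < n.+2) ((f i *+ i) * g (n.+1 - i)%N +
                               f i * (g (n.+1 - i)%N *+ (n.+1 - i)))).
  apply: eq_bigr => i _.
  by rewrite mulrnAl mulrnAr -mulrnDr subnKC // -ltnS.
rewrite big_split /=; congr (_ + _).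
  by rewrite big_ord_recl mulr0n mul0r add0r.
rewrite big_ord_recr /= subnn mulr0n mulr0 addr0.
by apply: eq_bigr => i _; rewrite subSn // -ltnS.
Qed.

Definition fps_map (D : R -> R) f : fps R := fun n => D (f n).

Lemma fps_mapD D : {morph D : a b / a + b} -> {morph fps_map D : f g / f + g}.
Proof. by move=> DD f g; apply: fpsP => n; apply: DD. Qed.

Lemma fps_mapM D : {morph D : a b / a + b} ->
  (forall a b, D (a * b) = D a * b + a * D b) ->
  forall f g, fps_map D (f * g) = fps_map D f * g + f * fps_map D g.
Proof.
move=> DD DM f g; apply: fpsP => n; rewrite /fps_map fpsDE !fpsME.
have D0 : D 0 = 0 by apply: (addIr (D 0)); rewrite -DD !add0r.
by rewrite (big_morph D DD D0) -big_split; apply: eq_bigr => i _; apply: DM.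
Qed.
End FpsRing.

(** * Formal power series in two variables *)

Definition fps_mono (R : comNzRingType) (a : R) (n : nat) : fps R :=
  fun i => if i == n then a else 0.

Lemma fps_monoME (R : comNzRingType) (a : R) n (f : fps R) k :
  (fps_mono a n * f) k = if (n <= k)%N then a * f (k - n)%N else 0.
Proof.
rewrite fpsME; case: leqP => [le_nk|lt_kn].
  rewrite (bigD1 (Ordinal (le_nk : n < k.+1)%N)) //= /fps_mono eqxx.
  by rewrite big1 ?addr0 // => i; rewrite -val_eqE => /= /negPf ->; rewrite mul0r.
rewrite big1 // => i _; rewrite /fps_mono; case: eqP => [E|]; last by rewrite mul0r.
by move: (leq_ord i); rewrite E leqNgt lt_kn.
Qed.

Section PowerSeriesInTwoVariables.
Variable K : fieldType.
Local Notation P := (fps (fps K)).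
Implicit Types (f g A B X Y : P).

Lemma fps2P f g : (forall p q, f p q = g p q) -> f = g.
Proof. by move=> fg; apply: fpsP => p; apply: fpsP => q. Qed.

Lemma fps2ME f g p q :
  (f * g) p q = \sum_(i < p.+1) \sum_(j < q.+1) f i j * g (p - i)%N (q - j)%N.
Proof. by rewrite fpsME fps_sumE; apply: eq_bigr => i _; rewrite fpsME. Qed.

Lemma fps2_mul_eq0 f g : f * g = 0 -> f = 0 \/ g = 0.
Proof.
apply: fps_mul_eq0; apply: fps_mul_eq0 => a b /eqP.
by rewrite mulf_eq0 => /orP[/eqP|/eqP]; [left|right].
Qed.

(** The series [a x^p y^q]: the outer index is the exponent of [x], the inner one that of [y]. The
    scalar [a] acts as [mono a 0 0]. *)
Definition mono (a : K) (p q : nat) : P := fps_mono (fps_mono a q) p.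

Lemma monoE a p q i j : mono a p q i j = if (i == p) && (j == q) then a else 0.
Proof. by rewrite /mono /fps_mono; case: (i == p). Qed.

Lemma monoME a p q f i j :
  (mono a p q * f) i j =
  if (p <= i)%N && (q <= j)%N then a * f (i - p)%N (j - q)%N else 0.
Proof. by rewrite fps_monoME; case: (p <= i)%N => //=; rewrite fps_monoME. Qed.

Lemma monoM a p q b r s : mono a p q * mono b r s = mono (a * b) (p + r) (q + s).
Proof.
apply: fps2P => i j; rewrite monoME !monoE.
case: leqP => [le_pi|lt_ip] /=; last by rewrite ltn_eqF // ltn_addr.
case: leqP => [le_qj|lt_jq] /=; last by rewrite (@ltn_eqF j) ?andbF // ltn_addr.
rewrite -(eqn_add2l p (i - p)) -(eqn_add2l q (j - q)) !subnKC //.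
by case: ifP => _; rewrite ?mulr0.
Qed.

Lemma mono1 : mono 1 0 0 = 1.
Proof.
apply: fps2P => i j; rewrite monoE fps1E.
by case: (i == 0%N) => //=; rewrite mulr1n fps1E; case: (j == 0%N).
Qed.

Lemma monoD a b p q : mono (a + b) p q = mono a p q + mono b p q.
Proof.
by apply: fps2P => i j; rewrite !fpsDE !monoE; case: ifP; rewrite ?addr0.
Qed.

Lemma mono0 p q : mono 0 p q = 0.
Proof. by apply: fps2P => i j; rewrite monoE if_same. Qed.

Definition dx f : P := fps_deriv f.
Definition dy f : P := fps_map (@fps_deriv K) f.

Lemma dxE f p q : dx f p q = f p.+1 q *+ p.+1.
Proof. exact: fps_mulrnE. Qed.
Lemma dyE f p q : dy f p q = f p q.+1 *+ q.+1. Proof. by []. Qed.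

Definition vfield A B f : P := A * dx f + B * dy f.

Lemma vfieldD A B f g : vfield A B (f + g) = vfield A B f + vfield A B g.
Proof.
rewrite /vfield /dx /dy fps_derivD (fps_mapD (@fps_derivD K)) !mulrDr.
by rewrite addrACA.
Qed.

Lemma vfieldM A B f g :
  vfield A B (f * g) = vfield A B f * g + f * vfield A B g.
Proof.
rewrite /vfield /dx /dy fps_derivM (fps_mapM (@fps_derivD K) (@fps_derivM K)).
by ring.
Qed.

Lemma vfieldX A B f n : vfield A B (f ^+ n) = f ^+ n.-1 * vfield A B f *+ n.
Proof.
elim: n => [|n IH].
  rewrite expr0 mulr0n; apply: (addIr (vfield A B 1)).
  by rewrite add0r -{1}(mulr1 (vfield A B 1)) -{2}(mul1r (vfield A B 1)) -vfieldM mulr1.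
rewrite exprS vfieldM IH /= mulrnAr mulrA mulrC.
case: n {IH} => [|n]; first by rewrite expr0 mulr0n addr0 mulr1n.
by rewrite -exprS [RHS]mulrS.
Qed.

Lemma dx_mono a p q : dx (mono a p q) = mono (a *+ p) p.-1 q.
Proof.
apply: fps2P => i j; rewrite dxE !monoE; case: p => [|p] /=.
  by rewrite mul0rn if_same.
by rewrite eqSS; case: andP => [[/eqP -> _]|]; rewrite ?mul0rn.
Qed.

Lemma dy_mono a p q : dy (mono a p q) = mono (a *+ q) p q.-1.
Proof.
apply: fps2P => i j; rewrite dyE !monoE; case: q => [|q] /=.
  by rewrite andbF mul0rn if_same.
by rewrite eqSS; case: andP => [[_ /eqP ->]|]; rewrite ?mul0rn.
Qed.

(** Membership in the n-th power of the ideal [(x, y)]. Mostly applied to differences, where it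
    means agreement in all total degrees below [n]. *)
Definition ordge (n : nat) f := forall p q, (p + q < n)%N -> f p q = 0.

Lemma ordge_leq n k f : (n <= k)%N -> ordge k f -> ordge n f.
Proof. by move=> le_nk fk p q lt_n; apply: fk; apply: leq_trans le_nk. Qed.

Lemma ordgeD n f g : ordge n f -> ordge n g -> ordge n (f + g).
Proof. by move=> fn gn p q pq; rewrite !fpsDE fn // gn // addr0. Qed.

Lemma ordgeM n k f g : ordge n f -> ordge k g -> ordge (n + k) (f * g).
Proof.
move=> fn gk p q pq; rewrite fps2ME big1 // => i _; rewrite big1 // => j _.
have [lt_n|le_n] := ltnP (i + j) n; first by rewrite fn ?mul0r.
rewrite gk ?mulr0 // -(ltn_add2l n); apply: leq_ltn_trans pq.
have Hi := leq_ord i; have Hj := leq_ord j.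
apply: leq_trans (leq_add le_n (leqnn _)) _.
by rewrite addnACA !subnKC.
Qed.

Lemma ordge_dx n f : ordge n.+1 f -> ordge n (dx f).
Proof. by move=> fn p q pq; rewrite dxE fn ?mul0rn. Qed.

Lemma ordge_dy n f : ordge n.+1 f -> ordge n (dy f).
Proof. by move=> fn p q pq; rewrite dyE fn ?mul0rn // addnS. Qed.

(** A derivative loses one degree and the coefficients gain two. The net gain of one degree makes
    the maps [Phi] below contractions. *)
Lemma ordge_vfield n A B f :
  ordge 2 A -> ordge 2 B -> ordge n f -> ordge n.+1 (vfield A B f).
Proof.
move=> A2 B2 fn; have fx : ordge n.-1 (dx f).
  by case: n fn => [|n] fn; [move=> p q | apply: ordge_dx].
have fy : ordge n.-1 (dy f).
  by case: n fn {fx} => [|n] fn; [move=> p q | apply: ordge_dy].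
have le_n : (n.+1 <= 2 + n.-1)%N by case: n {fn fx fy}.
by apply: (ordge_leq le_n); apply: ordgeD; apply: ordgeM.
Qed.

Lemma ordge_mono a p q : ordge (p + q) (mono a p q).
Proof.
move=> i j; rewrite monoE; case: andP => // -[/eqP -> /eqP ->].
by rewrite ltnn.
Qed.

(** Leading forms multiply: [f'] and [g'] stand for the lowest terms of [f] and [g]. *)
Lemma ordge_congM n k f f' g g' :
  ordge n f -> ordge k g' -> ordge n.+1 (f - f') -> ordge k.+1 (g - g') ->
  ordge (n + k).+1 (f * g - f' * g').
Proof.
move=> fn gk ff gg.
have -> : f * g - f' * g' = f * (g - g') + (f - f') * g'.
  by rewrite mulrBr mulrBl addrA subrK.
by apply: ordgeD; [rewrite -addnS | rewrite -addSn]; apply: ordgeM.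
Qed.

Lemma ordge_cong n f f' : ordge n.+1 (f - f') -> ordge n f' -> ordge n f.
Proof.
move=> ff f'n; rewrite -(subrK f' f); apply: ordgeD => //.
exact: (ordge_leq (leqnSn n)).
Qed.

Lemma ordge_congX X a p q n : ordge (p + q).+1 (X - mono a p q) ->
  ordge (n * p + n * q).+1 (X ^+ n - mono (a ^+ n) (n * p) (n * q)).
Proof.
move=> XX; elim: n => [|n IH]; first by rewrite mono1 !expr0 subrr.
rewrite !exprS !mulSn -monoM addnACA; apply: ordge_congM => //.
  exact: (ordge_cong XX (@ordge_mono _ _ _)).
exact: ordge_mono.
Qed.

(** The lowest term of [X^p Y^q] comes from the linear parts [s x] and [y] alone; this is the source
    of triangularity for substitutions. *)
Lemma mono_congXM X Y s p q :
  ordge 2 (X - mono s 1 0) -> ordge 2 (Y - mono 1 0 1) ->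
  ordge (p + q).+1 (X ^+ p * Y ^+ q - mono (s ^+ p) p q).
Proof.
move=> XX YY; have Xp := @ordge_congX X s 1 0 p XX.
have Yq := @ordge_congX Y 1 0 1 q YY.
rewrite !muln0 !muln1 addn0 add0n expr1n in Xp Yq.
have -> : mono (s ^+ p) p q = mono (s ^+ p) p 0 * mono 1 0 q.
  by rewrite monoM mulr1 addn0.
apply: ordge_congM => //.
- apply: (ordge_cong Xp); rewrite -{1}[p]addn0; exact: ordge_mono.
- exact: (@ordge_mono 1 0 q).
Qed.

(** Banach's fixed point theorem for the [(x, y)]-adic metric, by iteration from 0. *)
Lemma contraction_fixpoint (Phi : P -> P) :
  (forall n f g, ordge n (f - g) -> ordge n.+1 (Phi f - Phi g)) ->
  exists f, Phi f = f.
Proof.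
move=> PhiC; pose it n := iter n Phi 0.
have it_step n : ordge n (it n - it n.+1).
  by elim: n => [|n IH] //; apply: PhiC.
have it_le n k : ordge n (it n - it (n + k)%N).
  elim: k => [|k IH]; first by rewrite addn0 subrr.
  rewrite addnS -(subrK (it (n + k)%N) (it n)) -addrA; apply: ordgeD => //.
  by apply: (ordge_leq (leq_addr k n)); apply: it_step.
(* Coefficients of degree [p + q] are stable from the iterate [(p + q).+1] on, so the limit is read
   off diagonally. *)
pose f : P := fun p q => it (p + q).+1 p q.
have fE n : ordge n (f - it n).
  move=> p q pq; rewrite !fpsDE !fpsNE -(subnKC pq).
  exact: (it_le (p + q).+1 (n - (p + q).+1)%N p q (ltnSn _)).
exists f; apply: fps2P => p q; apply/eqP; rewrite -subr_eq0.
have := PhiC _ _ _ (fE (p + q)%N) p q (ltnSn _).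
have := fE (p + q).+1 p q (ltnSn _).
by rewrite !fpsDE !fpsNE => /subr0_eq -> /eqP.
Qed.

End PowerSeriesInTwoVariables.

(** * Linearizing coordinates up to the resonant term *)

Section NormalCoordinates.
Variable K : fieldType.
Hypothesis charK0 : [pchar K] =i pred0.
Local Notation P := (fps (fps K)).
Variables (m : nat) (m_gt1 : (1 < m)%N).
Local Notation c := (m%:R^-1 : K).

Lemma natr_inj (n k : nat) : n%:R = k%:R :> K -> n = k.
Proof.
have le_inj i j : (i <= j)%N -> i%:R = j%:R :> K -> i = j.
  move=> le_ij /eqP; rewrite eq_sym -subr_eq0 -natrB // (iffLR (pcharf0P K) charK0).
  by rewrite subn_eq0 => le_ji; apply/eqP; rewrite eqn_leq le_ij le_ji.
by case: (leqP n k) => [|/ltnW] le_nk E; [|apply/esym]; apply: le_inj.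
Qed.

Lemma natr_m_neq0 : m%:R != 0 :> K.
Proof. by rewrite (iffLR (pcharf0P K) charK0) -lt0n ltnW. Qed.

(* The eigenvalue [p + q / m] of [x^p y^q] equals [1] only for [x] and [y^m]. *)
Lemma resonance1 p q : p%:R + c * q%:R - 1 = 0 :> K ->
  (p == 1%N) && (q == 0%N) \/ (p == 0%N) && (q == m).
Proof.
move/subr0_eq/(congr1 ( *%R m%:R)).
rewrite mulrDr mulrA divff ?natr_m_neq0 // mul1r mulr1 -natrM -natrD.
by move/natr_inj; case: p => [|[|p]]; nia.
Qed.

Lemma resonance_c p q : p%:R + c * q%:R - c = 0 :> K -> (p == 0%N) && (q == 1%N).
Proof.
move/subr0_eq/(congr1 ( *%R m%:R)).
rewrite mulrDr mulrA divff ?natr_m_neq0 // mul1r -natrM -natrD.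
by move/(@natr_inj _ 1%N); case: p => [|p]; nia.
Qed.

Lemma vfield_linearE (f : P) p q :
  vfield (mono 1 1 0) (mono c 0 1) f p q = (p%:R + c * q%:R) * f p q.
Proof.
rewrite /vfield !fpsDE !monoME leq0n andbT /= !subn0 mul1r dxE dyE mulrDl.
congr (_ + _).
  by case: p => [|p] /=; rewrite ?mul0r // subn1 mulr_natl.
by case: q => [|q] /=; rewrite ?mulr0 ?mul0r // subn1 -mulrA mulr_natl.
Qed.

Variables A B : P.
Hypothesis A_lin : ordge 2 (A - mono 1 1 0).
Hypothesis B_lin : ordge 2 (B - mono c 0 1).
Local Notation N := (vfield (A - mono 1 1 0) (B - mono c 0 1)).

Lemma vfield_splitE (f : P) p q :
  vfield A B f p q = (p%:R + c * q%:R) * f p q + N f p q.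
Proof.
have -> : vfield A B f = vfield (mono 1 1 0) (mono c 0 1) f + N f.
  by rewrite /vfield; ring.
by rewrite !fpsDE vfield_linearE.
Qed.

(** The part of [N f] in degree [n] sees only the coefficients of [f] in degrees below [n], so the
    eigenvalue equations can be solved degree by degree. *)
Lemma vfield_higher_congr n (f g : P) p q :
  ordge n (f - g) -> (p + q < n.+1)%N -> N f p q = N g p q.
Proof.
move=> fg pq; rewrite -(subrK g f) vfieldD !fpsDE.
by rewrite (ordge_vfield A_lin B_lin fg) ?add0r.
Qed.

Lemma vfield_higher0 (f : P) p q : (p + q < 2)%N -> f 0%N 0%N = 0 -> N f p q = 0.
Proof.
move=> pq f0; apply: (ordge_vfield A_lin B_lin (n := 1)) => //.
by case=> [|i] [|j].
Qed.

Lemma ordge2_lin (f : P) a i j : (i + j = 1)%N -> f 0%N 0%N = 0 -> f i j = a ->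
  f j i = 0 -> ordge 2 (f - mono a i j).
Proof.
by case: i j => [|[|i]] [|[|j]] // _ f0 fi fj [|[|p]] [|[|q]] // _;
  rewrite !fpsDE !fpsNE monoE /= ?f0 ?fi ?fj ?subrr ?subr0.
Qed.

Lemma normal_coordinate_y :
  exists Y : P, ordge 2 (Y - mono 1 0 1) /\ vfield A B Y = mono c 0 0 * Y.
Proof.
(* Coefficientwise [v Y = c Y] reads [(p + c q - c) Y_pq = - (N Y)_pq]. At the resonant monomial [y]
   both sides vanish, and the free coefficient is normalized to 1. *)
pose Phi (f : P) : P := fun p q =>
  if (p == 0%N) && (q == 1%N) then 1 else - N f p q / (p%:R + c * q%:R - c).
have [n f g fg p q pq|Y Yfix] := @contraction_fixpoint K Phi.
  rewrite !fpsDE !fpsNE /Phi; case: ifP => _; first by rewrite subrr.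
  by rewrite (vfield_higher_congr fg pq) subrr.
have YE p q : Y p q = Phi Y p q by rewrite Yfix.
have Y00 : Y 0%N 0%N = 0.
  rewrite YE /Phi /= (_ : N Y 0%N 0%N = 0) ?oppr0 ?mul0r //.
  by apply: (@ordge_vfield _ 0 _ _ _ A_lin B_lin).
exists Y; split.
  apply: ordge2_lin => //.
  by rewrite YE /Phi /= vfield_higher0 ?oppr0 ?mul0r.
apply: fps2P => p q; rewrite monoME /= !subn0; apply/eqP; rewrite -subr_eq0.
rewrite vfield_splitE addrAC -mulrBl YE /Phi.
case: ifP => [/andP[/eqP -> /eqP ->]|npq].
  by rewrite vfield_higher0 // mulr0n add0r mulr1n !mulr1 subrr addr0.
rewrite mulrC divfK ?addNr //.
by apply/eqP => /resonance_c; rewrite npq.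
Qed.

Lemma normal_coordinate_x (Y : P) : ordge 2 (Y - mono 1 0 1) ->
  exists (X : P) (a : K), ordge 2 (X - mono 1 1 0) /\
    vfield A B X = X + mono a 0 0 * Y ^+ m.
Proof.
move=> Y_lin.
have Ym := @ordge_congX K Y 1 0 1 m Y_lin.
rewrite muln0 muln1 add0n expr1n in Ym.
have Ymm : ordge m (Y ^+ m) := ordge_cong Ym (@ordge_mono _ 1 0 m).
have Ym0m : (Y ^+ m) 0%N m = 1.
  by have /subr0_eq -> := Ym 0%N m (ltnSn m); rewrite monoE !eqxx.
(* [N f 0 m] is the coefficient [a] of the resonant term: it is determined by
   the terms of [f] of degree less than [m] and only affects those of degree at
   least [m], so that [Phi] is still a contraction. *)
pose Phi (f : P) : P := fun p q =>
  if (p == 1%N) && (q == 0%N) then 1 else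
  if (p == 0%N) && (q == m) then 0 else
    (N f 0%N m * (Y ^+ m) p q - N f p q) / (p%:R + c * q%:R - 1).
have [n f g fg p q pq|X Xfix] := @contraction_fixpoint K Phi.
  rewrite !fpsDE !fpsNE /Phi; case: ifP => _; first by rewrite subrr.
  case: ifP => _; first by rewrite subrr.
  rewrite (vfield_higher_congr fg pq).
  have [lt_nm|le_mn] := ltnP n m.
    by rewrite Ymm ?mulr0 ?subrr //; apply: leq_ltn_trans lt_nm.
  by rewrite (vfield_higher_congr fg (_ : 0 + m < n.+1)%N) ?subrr.
have XE p q : X p q = Phi X p q by rewrite Xfix.
have m0 : (0%N == m) = false by case: m m_gt1.
have m1 : (1%N == m) = false by case: m m_gt1 => [|[]].
have X00 : X 0%N 0%N = 0.
  rewrite XE /Phi /= m0 Ymm ?(ltnW m_gt1) // mulr0 sub0r.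
  rewrite (_ : N X 0%N 0%N = 0) ?oppr0 ?mul0r //.
  by apply: (@ordge_vfield _ 0 _ _ _ A_lin B_lin).
(* At [y^m] the factor [p + c q - 1] is zero and [Y^m] has coefficient 1, so the equation there
   forces this value of [a]. *)
exists X, (N X 0%N m); split.
  apply: ordge2_lin => //.
  by rewrite XE /Phi /= m1 Ymm // mulr0 vfield_higher0 // subrr mul0r.
apply: fps2P => p q; rewrite fpsDE fpsDE monoME /= !subn0; apply/eqP.
rewrite -subr_eq0 vfield_splitE opprD addrACA -{2}(mul1r (X p q)) -mulrBl XE /Phi.
case: ifP => [/andP[/eqP -> /eqP ->]|np1].
  rewrite vfield_higher0 // Ymm ?addn0 // mulr0n mulr1n !mulr0 addr0.
  by rewrite !subrr mul0r addr0.
case: ifP => [/andP[/eqP -> /eqP ->]|np2].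
  by rewrite Ym0m mulr1 subrr mulr0 addr0.
rewrite mulrC divfK; first by rewrite subrKA subrr.
by apply/eqP => /resonance1; rewrite np1 np2 => -[].
Qed.

End NormalCoordinates.

(** * Pairing power series with the symmetric coalgebra *)

Section LinearMapsOnMonoids.
Variables (K : fieldType) (T : choiceType) (V : lmodType K).

Lemma monalgU_scale (a : K) (t : T) : << a *g t >> = a *: << t >>.
Proof. by apply/malgP => s; rewrite mcoeffZ !mcoeffU mulrnAr mulr1. Qed.

Lemma linear_malgE (f : {linear {malg K[T]} -> V}) x :
  f x = \sum_(t <- msupp x) x@_t *: f << t >>.
Proof.
rewrite {1}[x]monalgE linear_sum; apply: eq_bigr => t _.
by rewrite monalgU_scale linearZ.
Qed.

Lemma eq_linear_malg (f g : {linear {malg K[T]} -> V}) :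
  (forall t, f << t >> = g << t >>) -> f =1 g.
Proof. by move=> fg x; rewrite !linear_malgE; apply: eq_bigr => t _; rewrite fg. Qed.
End LinearMapsOnMonoids.

Lemma big_mbelow (R : nmodType) (I : mindex) (F : mindex -> R) :
  \sum_(J <- mbelow I) F J =
  \sum_(a < I.1.1.+1) \sum_(b < I.1.2.+1) \sum_(k < I.2.+1) F (val a, val b, val k).
Proof.
have E n (G : nat -> R) : \sum_(a <- iota 0 n) G a = \sum_(a < n) G a.
  by rewrite -[n in iota 0 n]subn0 big_mkord.
rewrite /mbelow big_allpairs big_allpairs E; apply: eq_bigr => a _.
by rewrite E; apply: eq_bigr => b _; rewrite E.
Qed.

Section Pairing.
Variable K : fieldType.
Hypothesis charK0 : [pchar K] =i pred0.
Local Notation P := (fps (fps K)).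
Local Notation SW := (SymW K).
Local Notation SW2 := (SymW2 K).
Implicit Types (F G X Y : P) (e : nat) (I J : mindex) (x y : SW).

Lemma fact_neq0 n : n`!%:R != 0 :> K.
Proof. by rewrite (iffLR (pcharf0P K) charK0) -lt0n fact_gt0. Qed.

(* [pairing e F] is the functional on S(W) given by the series [xi^e F], where
   [x^p y^q] takes the value [p! q!] on [w_2^p w_3^q].  The constant term of [F]
   is invisible when [e = 0], since S(W) has no component of degree 0. *)
Definition pairing_mon e F I : K :=
  if I.1.1 == e then I.1.2`!%:R * I.2`!%:R * F I.1.2 I.2 else 0.

Definition pairing e F : {linear SW -> K^o} :=
  linext (fun I : mon => pairing_mon e F (val I) : K^o).

(** The product functional on S(W) (x) S(W), without Koszul sign: a sign could occur only for
    [e = e' = 1], where the functional vanishes on the image of [Delta]. *)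
Definition pairing2 e F e' G : {linear SW2 -> K^o} :=
  linext (fun IJ : mon * mon =>
    pairing_mon e F (val IJ.1) * pairing_mon e' G (val IJ.2) : K^o).

Lemma pairingU e F (I : mon) : pairing e F << I >> = pairing_mon e F (val I).
Proof. exact: linextU. Qed.

Lemma pairing2U e F e' G (I J : mon) : pairing2 e F e' G << (I, J) >> =
  pairing_mon e F (val I) * pairing_mon e' G (val J).
Proof. exact: (linextU _ (I, J)). Qed.

Lemma wE I (IP : is_mon I) : w K I = << (Sub I IP : mon) >>.
Proof. by rewrite /w insubT. Qed.

Lemma w_out I : ~~ is_mon I -> w K I = 0.
Proof. by move=> IP; rewrite /w insubN. Qed.

Lemma w_val (I : mon) : w K (val I) = << I >>.
Proof. by rewrite (wE (valP I)); congr << _ >>; apply: val_inj. Qed.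

Lemma pairing_w e F I :
  pairing e F (w K I) = if is_mon I then pairing_mon e F I else 0.
Proof.
case: (boolP (is_mon I)) => IP; last by rewrite w_out ?linear0.
by rewrite (wE IP) pairingU.
Qed.

(** When the constant term is zero, the formula agrees with the convention [w_0 = 0], so sums over
    all [J] below [I] need no special case at their ends. *)
Lemma pairing_w_aug e F I : (I.1.1 <= 1)%N -> (e = 0%N -> F 0%N 0%N = 0) ->
  pairing e F (w K I) = pairing_mon e F I.
Proof.
case: I => [[i p] q] /= i_le1 F00; rewrite pairing_w /is_mon /= i_le1 /=.
rewrite /mdegree /= /pairing_mon /=; case: ltnP => // .
rewrite leqn0 !addn_eq0 => /andP[/andP[/eqP -> /eqP ->] /eqP ->].
by case: eqP => // e0; rewrite F00 ?mulr0.
Qed.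

Lemma pairingE e F x :
  pairing e F x = \sum_(I <- msupp x) x@_I * pairing_mon e F (val I).
Proof. by []. Qed.

Lemma pairing_lin e a F G x :
  pairing e (mono a 0 0 * F + G) x = a * pairing e F x + pairing e G x.
Proof.
rewrite !pairingE mulr_sumr -big_split /=; apply: eq_bigr => I _.
rewrite /pairing_mon; case: eqP => _; last by rewrite !mulr0 addr0.
by rewrite !fpsDE monoME /= !subn0; ring.
Qed.

Lemma pairingZ e a F x : pairing e (mono a 0 0 * F) x = a * pairing e F x.
Proof.
have p0 : pairing e 0 x = 0.
  rewrite pairingE big1 // => I _.
  by rewrite /pairing_mon fps0E mulr0 if_same mulr0.
by have := pairing_lin e a F 0 x; rewrite p0 !addr0.
Qed.

Lemma pairingD e F G x : pairing e (F + G) x = pairing e F x + pairing e G x.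
Proof. by have := pairing_lin e 1 F G x; rewrite mono1 !mul1r. Qed.

Lemma pairing0 e x : pairing e 0 x = 0.
Proof. by rewrite -(mulr0 (mono 0 0 0)) pairingZ mul0r. Qed.

Lemma pairing_mon_mono e p q I :
  pairing_mon e (mono 1 p q) I = if I == (e, p, q) then p`!%:R * q`!%:R else 0.
Proof.
case: I => [[i a] b]; rewrite /pairing_mon monoE /= !xpair_eqE.
case: eqP => //= _; case: eqP => /= [->|]; last by rewrite mulr0.
by case: eqP => [->|]; rewrite ?mulr1 ?mulr0.
Qed.

Lemma pairing_mono e p q x (J : mon) : val J = (e, p, q) ->
  pairing e (mono 1 p q) x = p`!%:R * q`!%:R * x@_J.
Proof.
move=> JE; rewrite pairingE.
under eq_bigr do rewrite pairing_mon_mono -JE (inj_eq val_inj).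
have [Jx|Jx] := boolP (J \in msupp x); last first.
  rewrite mcoeff_outdom // mulr0 big_seq big1 // => I Ix.
  by case: eqP => [IJ|]; rewrite ?mulr0 //; rewrite -IJ Ix in Jx.
rewrite (big_fsetD1 J) //= eqxx [RHS]mulrC big_seq big1 ?addr0 // => I.
by rewrite !inE => /andP[/negPf -> _]; rewrite mulr0.
Qed.

Lemma pairing_ext x y :
  (forall e a b, pairing e (mono 1 a b) x = pairing e (mono 1 a b) y) -> x = y.
Proof.
move=> xy; apply/malgP => J; case JE : (val J) => [[e a] b].
have := xy e a b; rewrite !(pairing_mono _ JE); apply: mulfI.
by rewrite mulf_neq0 ?fact_neq0.
Qed.

End Pairing.

(** * Coderivations as vector fields *)

Section Coderivations.
Variable K : fieldType.
Hypothesis charK0 : [pchar K] =i pred0.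
Local Notation P := (fps (fps K)).
Local Notation SW := (SymW K).
Local Notation W := (Wsp K).
Implicit Types (F G X Y : P) (e : nat) (I J : mindex) (x y : SW).
Let fact0 := fact_neq0 charK0.

(** Since [C(p, b) b! (p - b)! = p!], the weighted binomial convolution is the ordinary product of
    series. *)
Lemma fact_convolution (S T : P) p q :
  \sum_(b < p.+1) \sum_(k < q.+1) ('C(p, b) * 'C(q, k))%:R *
     (b`!%:R * k`!%:R * S b k) *
     ((p - b)`!%:R * (q - k)`!%:R * T (p - b)%N (q - k)%N)
  = p`!%:R * q`!%:R * (S * T) p q.
Proof.
rewrite fps2ME mulr_sumr; apply: eq_bigr => b _.
rewrite mulr_sumr; apply: eq_bigr => k _.
rewrite -(bin_fact (leq_ord b)) -(bin_fact (leq_ord k)) !natrM.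
by ring.
Qed.

Lemma pairing_comb e F (I : Type) (r : seq I) (a : I -> K) (y : I -> SW) :
  pairing e F (\sum_(i <- r) a i *: y i) = \sum_(i <- r) a i * pairing e F (y i).
Proof. by rewrite linear_sum; apply: eq_bigr => i _; rewrite linearZ. Qed.

(* For odd [phi] the vector field dual to [coder phi] has the coefficients
   [A], [B] and [E] with [e], [j] equal to [1], [i2], to [1], [i3] and to
   [0], [i1] respectively. *)
Definition component_series (phi : SW -> W) e (j : 'I_3) : P :=
  fun p q => phi (w K (e, p, q)) 0 j / (p`!%:R * q`!%:R).

Lemma component_seriesE (phi : SW -> W) e j p q :
  phi (w K (e, p, q)) 0 j = p`!%:R * q`!%:R * component_series phi e j p q.
Proof. by rewrite mulrC divfK // mulf_neq0 ?fact0. Qed.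

Lemma homL_w (phi : {linear SW -> W}) I j :
  homL true phi -> godd j != ~~ modd I -> phi (w K I) 0 j = 0.
Proof.
move=> hom; have [IP|IP] := boolP (is_mon I); last first.
  by rewrite w_out // linear0 mxE.
rewrite (wE _ IP) => Ij; apply/eqP; apply: contraNT Ij => /hom ->.
by rewrite addbT eqxx.
Qed.

Lemma big_ord3 (F : 'I_3 -> K) : \sum_j F j = F i1 + (F i2 + F i3).
Proof.
rewrite !big_ord_recl big_ord0 addr0.
by congr (F _ + (F _ + F _)); apply: val_inj.
Qed.

Lemma pairing_mulW e F (v : W) I : pairing e F (mulW v I) =
  v 0 i1 * pairing e F (w K (madd (munit i1) I)) +
  (v 0 i2 * pairing e F (w K (madd (munit i2) I)) +
   v 0 i3 * pairing e F (w K (madd (munit i3) I))).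
Proof. by rewrite /mulW pairing_comb big_ord3. Qed.

Lemma pairing_coderU e F (phi : SW -> W) (I : mon) i p q : val I = (i, p, q) ->
  pairing e F (coder phi << I >>) =
  \sum_(a < i.+1) \sum_(b < p.+1) \sum_(k < q.+1)
    ('C(i, a) * 'C(p, b) * 'C(q, k))%:R *
    pairing e F (mulW (phi (w K (val a, val b, val k))) (i - a, p - b, q - k)%N).
Proof. by move=> IE; rewrite /coder linextU IE pairing_comb big_mbelow. Qed.

HB.instance Definition _ (phi : SW -> W) :=
  GRing.isLinear.Build K SW SW *:%R (coder phi) (linext_is_linear _).

Variable phi : {linear SW -> W}.
Hypothesis phi_odd : homL true phi.
Local Notation A := (component_series phi 1 i2).
Local Notation B := (component_series phi 1 i3).
Local Notation E := (component_series phi 0 i1).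

(** The transpose of [coder phi] sends [F] to [xi (A dx F + B dy F)]: replacing [w_J] by [w_2] or
    [w_3] raises an exponent of the remaining monomial by one, and the extra factor in its factorial
    is that of the derivative. *)
Lemma pairing_coder0 F x :
  pairing 0 F (coder phi x) = pairing 1 (vfield A B F) x.
Proof.
apply: (eq_linear_malg (f := pairing 0 F \o coder phi)
                       (g := pairing 1 (vfield A B F))) => I /=.
case IE : (val I) => [[i p] q]; rewrite (pairing_coderU _ _ _ IE) pairingU IE.
have := valP I; rewrite IE /is_mon /= => /andP[i_le1 _].
(* When [w_J] does not contain [w_1], the odd map [phi] sends it to a multiple of [w_1], which
   functionals with [e = 0] do not see. *)
have phi0 b k : pairing 0 F (mulW (phi (w K (0, b, k)%N)) (i, p - b, q - k)%N) = 0.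
  by rewrite pairing_mulW !(homL_w (j := i2) phi_odd, homL_w (j := i3) phi_odd) //
     !pairing_w !mul0r /pairing_mon /= if_same mulr0 !addr0.
case: i i_le1 IE phi0 => [|[|//]] _ IE phi0; rewrite /pairing_mon /=.
  rewrite big_ord_recl big_ord0 addr0 big1 // => b _; rewrite big1 // => k _ /=.
  by rewrite phi0 mulr0.
rewrite big_ord_recl.
rewrite big_ord1.
rewrite [X in X + _](_ : _ = 0); last first.
  by apply: big1 => b _; apply: big1 => k _ /=; rewrite phi0 mulr0.
rewrite add0r.
rewrite /vfield fpsDE fpsDE.
rewrite mulrDr.
rewrite -!fact_convolution.
rewrite -big_split /=.
apply: eq_bigr => b _; rewrite -big_split /=; apply: eq_bigr => k _.
rewrite pairing_mulW homL_w // mul0r add0r !pairing_w /pairing_mon /=.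
rewrite !component_seriesE dxE dyE /is_mon /mdegree /= !addn0 !add0n !add1n addnS.
rewrite (_ : bump 0 0 = 1%N) // binn mul1n /= (factS (p - b)) (factS (q - k)).
rewrite !natrM -(mulr_natr (F _.+1 _)) -(mulr_natr (F _ _.+1)).
by ring.
Qed.

(** On [xi F] the part [xi (A dx + B dy)] gives nothing because [xi^2 = 0]; what is left is
    [E dxi (xi F) = E F]. *)
Lemma pairing_coder1 F x :
  pairing 1 F (coder phi x) = pairing 0 (E * F) x.
Proof.
apply: (eq_linear_malg (f := pairing 1 F \o coder phi)
                       (g := pairing 0 (E * F))) => I /=.
case IE : (val I) => [[i p] q]; rewrite (pairing_coderU _ _ _ IE) pairingU IE.
have := valP I; rewrite IE /is_mon /= => /andP[i_le1 _].
case: i i_le1 IE => [|[|//]] _ IE; rewrite /pairing_mon /=; last first.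
  (* For [w_I] containing [w_1], either the remainder keeps it and is multiplied by a second [w_1],
     or [w_J] takes it and no [w_1] is left in the result. *)
  apply: big1 => a _; apply: big1 => b _; apply: big1 => k _.
  case: a => [[|[|//]]] /= _; rewrite pairing_mulW.
    rewrite (homL_w (j := i2)) // (homL_w (j := i3)) //.
    by rewrite pairing_w /= !mul0r !mulr0 !addr0 mulr0.
  rewrite (homL_w (j := i1)) // !pairing_w /pairing_mon /=.
  by rewrite !if_same !mulr0 !mul0r !addr0 mulr0.
rewrite big_ord1 -fact_convolution.
apply: eq_bigr => b _; apply: eq_bigr => k _ /=.
rewrite pairing_mulW (homL_w (j := i2)) // (homL_w (j := i3)) // !mul0r !addr0.
rewrite pairing_w /pairing_mon /= component_seriesE /is_mon /mdegree /=.
by rewrite bin0 mul1n !add0n !mulrA.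
Qed.

(** The bracket of [coder phi] with itself is twice its square. The transpose of the square sends
    [x] first to [xi A] and then to [E A], and series over a field have no zero divisors. *)
Lemma codifferential_series0 :
  codifferential phi -> A != 0 -> E = 0.
Proof.
move=> [_ phi2] A0.
have phi2_0 x : coder phi (coder phi x) = 0.
  have := phi2 x; rewrite /gbracket /= expr1 scaleN1r opprK -mulr2n -scaler_nat.
  move/eqP; rewrite scaler_eq0 (iffLR (pcharf0P K) charK0) /=.
  by move/eqP.
have [|//|A_0] := @fps2_mul_eq0 K E A; last by rewrite A_0 eqxx in A0.
apply: fps2P => p q.
(* The pairing cannot see the constant term of [E A], but that of [E] is zero by the convention
   [w_0 = 0]. *)
have [/eqP|pq] := posnP (p + q).
  rewrite addn_eq0 => /andP[/eqP -> /eqP ->].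
  rewrite fps2ME big_ord1 big_ord1 /component_series w_out // linear0 mxE mul0r.
  by rewrite mul0r.
have IP : is_mon (0, p, q)%N by rewrite /is_mon /mdegree.
have := pairing_coder0 (mono 1 1 0) (coder phi << (Sub (0, p, q)%N IP : mon) >>).
rewrite phi2_0 linear0 /vfield dx_mono dy_mono /= !mulr0n mono0 mulr0 addr0.
rewrite mulr1n mono1 mulr1.
rewrite pairing_coder1 pairingU /pairing_mon /= => /esym/eqP.
by rewrite mulf_eq0 mulf_eq0 !(negPf (fact0 _)) /= => /eqP.
Qed.
End Coderivations.

(** * The comultiplication is dual to the product *)

Section Comultiplication.
Variable K : fieldType.
Hypothesis charK0 : [pchar K] =i pred0.
Local Notation P := (fps (fps K)).
Local Notation SW := (SymW K).
Local Notation SW2 := (SymW2 K).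
Implicit Types (F G X Y : P) (e : nat) (x y : SW).
Let fact0 := fact_neq0 charK0.

HB.instance Definition _ :=
  GRing.isLinear.Build K SW SW2 *:%R (@Delta K) (linext_is_linear _).
HB.instance Definition _ p (f g : SW -> SW) :=
  GRing.isLinear.Build K SW2 SW2 *:%R (tensmap p f g) (linext_is_linear _).

Lemma tensE x y : tens x y =
  \sum_(I <- msupp x) \sum_(J <- msupp y) (x@_I * y@_J) *: << (I, J) >>.
Proof.
apply: eq_bigr => I _; apply: eq_bigr => J _; exact: monalgU_scale.
Qed.

Lemma tens_coef x y (I J : mon) : (tens x y)@_(I, J) = x@_I * y@_J.
Proof.
have E z (L : mon) : z@_L = \sum_(M <- msupp z) z@_M *+ (M == L) :> K.
  rewrite {1}[z]monalgE raddf_sum; apply: eq_bigr => M _; exact: mcoeffU.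
rewrite (E x I) (E y J) mulr_suml raddf_sum; apply: eq_bigr => A _.
rewrite mulr_sumr raddf_sum; apply: eq_bigr => B _ /=.
by rewrite mcoeffU xpair_eqE mulrnAl mulrnAr -mulrnA mulnb andbC.
Qed.

Lemma tensUU (I J : mon) : tens << I >> << J >> = << (I, J) >> :> SW2.
Proof.
by apply/malgP => -[A B]; rewrite tens_coef !mcoeffU xpair_eqE -natrM mulnb.
Qed.

Lemma tensmapU (f g : SW -> SW) (I J : mon) :
  tensmap false f g << (I, J) >> = tens (f << I >>) (g << J >>).
Proof. by rewrite /tensmap linextU expr0 scale1r. Qed.

Lemma tensmap_tens (f g : {linear SW -> SW}) x y :
  tensmap false f g (tens x y) = tens (f x) (g y).
Proof.
have E (h : {linear SW -> SW}) z (L : mon) :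
    (h z)@_L = \sum_(M <- msupp z) z@_M * (h << M >>)@_L.
  by rewrite linear_malgE raddf_sum; apply: eq_bigr => M _; apply: mcoeffZ.
apply/malgP => -[I J]; rewrite tens_coef tensE (E f) (E g).
rewrite linear_sum raddf_sum mulr_suml; apply: eq_bigr => A _.
rewrite linear_sum raddf_sum mulr_sumr; apply: eq_bigr => B _ /=.
rewrite linearZ mcoeffZ /= tensmapU tens_coef.
by rewrite mulrACA.
Qed.

Lemma tensmap_cancel (f g : {linear SW -> SW}) :
  cancel f g -> cancel (tensmap false f f) (tensmap false g g).
Proof.
move=> fg; apply: (eq_linear_malg (f := tensmap false g g \o tensmap false f f)
                                  (g := idfun)) => -[I J] /=.
rewrite tensmapU tensmap_tens; exact: etrans (congr2 _ (fg _) (fg _)) (tensUU _ _).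
Qed.

Lemma pairing2_tens e F e' G x y :
  pairing2 e F e' G (tens x y) = pairing e F x * pairing e' G y.
Proof.
rewrite tensE !pairingE linear_sum mulr_suml; apply: eq_bigr => I _.
rewrite linear_sum mulr_sumr; apply: eq_bigr => J _ /=.
by rewrite linearZ /= pairing2U mulrACA.
Qed.

Lemma pairing2_mono e p q e' p' q' (z : SW2) (I J : mon) :
  val I = (e, p, q) -> val J = (e', p', q') ->
  pairing2 e (mono 1 p q) e' (mono 1 p' q') z =
  (p`!%:R * q`!%:R) * (p'`!%:R * q'`!%:R) * z@_(I, J).
Proof.
move=> IE JE; rewrite linear_malgE.
have -> : z@_(I, J) = \sum_(M <- msupp z) z@_M *+ (M == (I, J)).
  rewrite {1}[z]monalgE raddf_sum; apply: eq_bigr => M _; exact: mcoeffU.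
rewrite mulr_sumr; apply: eq_bigr => -[A B] _; rewrite pairing2U !pairing_mon_mono.
rewrite -IE -JE !(inj_eq val_inj) xpair_eqE /GRing.scale /=.
by case: eqP => _; case: eqP => _; rewrite /= ?mulr1n ?mulr0n; ring.
Qed.

Lemma pairing2_ext (z t : SW2) :
  (forall e p q e' p' q', (e = 0%N -> 0 < p + q)%N -> (e' = 0%N -> 0 < p' + q')%N ->
     pairing2 e (mono 1 p q) e' (mono 1 p' q') z =
     pairing2 e (mono 1 p q) e' (mono 1 p' q') t) -> z = t.
Proof.
move=> zt; apply/malgP => -[I J].
case IE : (val I) => [[e p] q]; case JE : (val J) => [[e' p'] q'].
have := zt e p q e' p' q'; rewrite !(pairing2_mono _ IE JE) => E.
apply: (mulfI _ (E _ _)); first by rewrite !mulf_neq0 ?fact0.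
  by move=> e0; have := valP I; rewrite IE /is_mon e0 /mdegree.
by move=> e0; have := valP J; rewrite JE /is_mon e0 /mdegree.
Qed.

Lemma split_parity (V : nmodType) (i e e' : nat) (s : V) : (i <= 1)%N ->
  \sum_(a < i.+1) (if (a == e :> nat) && ((i - a)%N == e') then s else 0) =
  if i == (e + e')%N then s else 0.
Proof.
case: i => [|[|//]] _; rewrite ?big_ord_recl big_ord0 addr0 /=.
  by case: e; case: e'.
by case: e => [|[|e]]; case: e' => [|[|e']]; rewrite ?addr0 ?add0r.
Qed.

(** The conditions on constant terms reflect that [Delta] is the reduced comultiplication: its terms
    [J = 0] and [J = I] vanish. *)
Lemma pairing2_Delta e F e' G x :
  (e = 0%N -> F 0%N 0%N = 0) -> (e' = 0%N -> G 0%N 0%N = 0) ->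
  pairing2 e F e' G (Delta x) = pairing (e + e') (F * G) x.
Proof.
move=> F0 G0.
apply: (eq_linear_malg (f := pairing2 e F e' G \o @Delta K)
                       (g := pairing (e + e') (F * G))) => I /=.
rewrite /Delta linextU pairingU linear_sum.
have := valP I; case: (val I) => [[i p] q] /= /andP[/= i_le1 _].
rewrite big_mbelow /= /pairing_mon /= -fact_convolution //.
transitivity (\sum_(a < i.+1) if (a == e :> nat) && ((i - a)%N == e') then
   \sum_(b < p.+1) \sum_(k < q.+1) ('C(p, b) * 'C(q, k))%:R *
     (b`!%:R * k`!%:R * F b k) *
     ((p - b)`!%:R * (q - k)`!%:R * G (p - b)%N (q - k)%N) else 0).
  apply: eq_bigr => a _.
  have a_le1 : (a <= 1)%N by apply: leq_trans (leq_ord a) i_le1.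
  have C1 : 'C(i, a) = 1%N.
    by case: i a i_le1 a_le1 => [|[|//]] [[|[|//]]].
  case: ifP => ae; last first.
    apply: big1 => b _; apply: big1 => k _; rewrite linearZ /= pairing2_tens.
    rewrite !pairing_w_aug //=; last by apply: leq_trans (leq_subr _ _) i_le1.
    rewrite /pairing_mon /=; move: ae; case: eqP => //= _; last by rewrite mul0r scaler0.
    by move=> ->; rewrite mulr0 scaler0.
  apply: eq_bigr => b _; apply: eq_bigr => k _; rewrite linearZ /= pairing2_tens.
  rewrite !pairing_w_aug //=; last by apply: leq_trans (leq_subr _ _) i_le1.
  case/andP: ae => ae iae; rewrite /pairing_mon /= ae iae /mbinom /= C1 mul1n.
  exact: mulrA.
exact: split_parity.
Qed.
End Comultiplication.

(** * Coalgebra automorphisms from substitutions *)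

Section TriangularMaps.
Variable K : fieldType.
Local Notation SW := (SymW K).

Definition triangular_at (I : mon) (y : SW) : Prop :=
  y@_I != 0 /\ forall J, y@_J != 0 -> J = I \/
    modd (val J) = modd (val I) /\ (mdegree (val J) < mdegree (val I))%N.

Definition triangular (f : SW -> SW) : Prop := forall I, triangular_at I (f << I >>).

Lemma triangular_homS f : triangular f -> homS false f.
Proof. by move=> ft I J /(proj2 (ft I)) [->|[-> _]]; rewrite addbF. Qed.

(** Induction on the degree: a preimage of a monomial is corrected by preimages of the lower terms
    of its image. *)
Lemma triangular_right_inverse (f : {linear SW -> SW}) : triangular f ->
  exists2 g : {linear SW -> SW}, triangular g & cancel g f.
Proof.
move=> ft; pose sol I y := triangular_at I y /\ f y = << I >>.
suff /choice[G GP] : forall I, exists y, sol I y.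
  exists (linext G); first by move=> I; rewrite /= linextU; apply: (GP I).1.
  apply: (eq_linear_malg (f := f \o linext G) (g := idfun)) => I /=.
  by rewrite linextU; apply: (GP I).2.
move=> I; have [n le_n] := ubnP (mdegree (val I)); elim: n I le_n => // n IH I le_n.
have /choice[Y YP] J : exists y, (mdegree (val J) < mdegree (val I))%N -> sol J y.
  have [lt_JI|] := boolP (mdegree (val J) < mdegree (val I))%N; last by exists 0.
  have [y yP] := IH J (leq_trans lt_JI le_n); by exists y.
have [fII fIJ] := ft I; set z := f << I >> in fII fIJ.
pose r := \sum_(J <- msupp z | J != I) z@_J *: Y J.
have lowJ J : J \in msupp z -> J != I ->
    modd (val J) = modd (val I) /\ (mdegree (val J) < mdegree (val I))%N.
  by rewrite -mcoeff_neq0 => /fIJ[->|//]; rewrite eqxx.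
have rcoef L : r@_L != 0 ->
    modd (val L) = modd (val I) /\ (mdegree (val L) < mdegree (val I))%N.
  move=> rL; apply: contrapT => nL; case/eqP: rL.
  rewrite raddf_sum big_seq_cond big1 // => J /andP[Jz JI] /=; rewrite mcoeffZ.
  have [oJ dJ] := lowJ J Jz JI; have [[_ YJ] _] := YP J dJ.
  have [->|/eqP YL] := eqVneq (Y J)@_L 0; first exact: mulr0.
  case: nL; case: (YJ L); first exact/eqP.
    by move=> ->.
  by move=> [-> dL]; split=> //; apply: ltn_trans dJ.
have rI : r@_I = 0 by apply/eqP; apply: contraT => /rcoef[_]; rewrite ltnn.
exists ((z@_I)^-1 *: (<< I >> - r)); split; first split.
- by rewrite mcoeffZ mcoeffB rI subr0 mcoeffUU mulr1 invr_eq0.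
- move=> J; rewrite mcoeffZ mcoeffB mcoeffU; case: (eqVneq I J) => [->|_]; first by left.
  rewrite mulr0n sub0r mulf_eq0 negb_or oppr_eq0 => /andP[_ /rcoef]; by right.
rewrite linearZ linearB /= -/z.
have -> : f r = \sum_(J <- msupp z | J != I) z@_J *: << J >>.
  rewrite linear_sum big_seq_cond [RHS]big_seq_cond.
  apply: eq_bigr => J /andP[Jz JI]; rewrite linearZ /=.
  by have [_ ->] := YP J (lowJ J Jz JI).2.
suff -> : z - \sum_(J <- msupp z | J != I) z@_J *: << J >> = z@_I *: << I >>.
  by rewrite scalerA mulVf // scale1r.
rewrite {1}[z]monalgE (bigD1_seq I) ?fset_uniq //= -?mcoeff_neq0 //.
rewrite monalgU_scale; under eq_bigr do rewrite monalgU_scale.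
exact: addrK.
Qed.

(** The right inverse is again triangular, hence has a right inverse itself, and so is two-sided. *)
Lemma triangular_bijective (f : {linear SW -> SW}) : triangular f ->
  exists2 g : {linear SW -> SW}, triangular g & cancel f g /\ cancel g f.
Proof.
move=> /triangular_right_inverse[g gt fg]; exists g => //; split=> // x.
have [g' _ gg'] := triangular_right_inverse gt.
by rewrite -{1}(gg' x) fg gg'.
Qed.
End TriangularMaps.

(** * Transposes of coordinate substitutions *)

Section Substitution.
Variable K : fieldType.
Hypothesis charK0 : [pchar K] =i pred0.
Local Notation P := (fps (fps K)).
Local Notation SW := (SymW K).
Local Notation SW2 := (SymW2 K).
Let fact0 := fact_neq0 charK0.
Variables (X Y : P) (s : K).
Hypothesis X_lin : ordge 2 (X - mono s 1 0).
Hypothesis Y_lin : ordge 2 (Y - mono 1 0 1).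

(** The transposed matrix of [F(x, y) -> F(X, Y)], with factorials from the pairing. Since [X^a Y^b]
    has order at least [a + b], indices above [p + q] contribute nothing and the sum is finite. *)
Definition subst_fun (I : mon) : SW :=
  let: (i, p, q) := val I in
  \sum_(a < (p + q).+1) \sum_(b < (p + q).+1)
    (p`!%:R * q`!%:R * (X ^+ a * Y ^+ b) p q / (a`!%:R * b`!%:R)) *:
    w K (i, val a, val b).

(* The transpose of the substitution [x := X, y := Y] in power series. *)
Definition subst : {linear SW -> SW} := linext subst_fun.

Lemma ordge_XY a b : ordge (a + b) (X ^+ a * Y ^+ b).
Proof. exact: (ordge_cong (mono_congXM X_lin Y_lin) (@ordge_mono _ _ _ _)). Qed.

Lemma pairing_subst1 e a b x :
  pairing e (mono 1 a b) (subst x) = pairing e (X ^+ a * Y ^+ b) x.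
Proof.
apply: (eq_linear_malg (f := pairing e (mono 1 a b) \o subst)
                       (g := pairing e (X ^+ a * Y ^+ b))) => I.
rewrite /= linextU pairingU /subst_fun.
have := valP I; case: (val I) => [[i p] q] IP; rewrite linear_sum.
under eq_bigr do rewrite pairing_comb.
have XY0 : (p + q < a + b)%N -> (X ^+ a * Y ^+ b) p q = 0 by apply: ordge_XY.
have [ie|nie] := eqVneq i e; last first.
  rewrite /pairing_mon (negPf nie); apply: big1 => a' _; apply: big1 => b' _.
  by rewrite pairing_w pairing_mon_mono !xpair_eqE (negPf nie) if_same mulr0.
have term a' b' : p`!%:R * q`!%:R * (X ^+ a' * Y ^+ b') p q / (a'`!%:R * b'`!%:R) *
    pairing e (mono 1 a b) (w K (i, a', b')) = if a' == a then
      if b' == b then p`!%:R * q`!%:R * (X ^+ a * Y ^+ b) p q else 0 else 0.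
  rewrite pairing_w pairing_mon_mono !xpair_eqE ie eqxx /=.
  have [->|_] := eqVneq a' a; last by rewrite if_same mulr0.
  have [->|_] := eqVneq b' b; last by rewrite if_same mulr0.
  case: ifP => [_|nab]; first by rewrite divfK // mulf_neq0 ?fact0.
  (* Only [e = a = b = 0] is left. There the series is 1, whose coefficient at [(p, q)] is zero
     because [p + q > 0]. *)
  rewrite mulr0; move: nab IP; rewrite /is_mon /mdegree ie /=.
  case: (e) => [|[|e']] //=; case: (a) => [|a0] //; case: (b) => [|b0] //= _ pq.
  rewrite !expr0 mulr1 fps1E; move: pq; case: (p) => [|p0] /=; last by rewrite mulr0.
  by case: (q) => //= q0 _; rewrite (mulr1n (1 : fps K)) fps1E mulr0.
under eq_bigr do under eq_bigr do rewrite term.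
rewrite /pairing_mon ie eqxx /=.
have [lt_D|ge_D] := ltnP (p + q) (a + b).
  rewrite XY0 // mulr0; apply: big1 => a' _; apply: big1 => b' _.
  by rewrite !if_same.
pose T := p`!%:R * q`!%:R * (X ^+ a * Y ^+ b) p q.
rewrite -/T.
transitivity (\sum_(a' < (p + q).+1) if a' == a :> nat then T else 0).
  apply: eq_bigr => a' _; case: eqP => _; last exact: big1.
  rewrite -big_mkcond (big_ord1_eq _ (fun=> T)) ltnS.
  by rewrite (leq_trans (leq_addl a b)).
by rewrite -big_mkcond (big_ord1_eq _ (fun=> T)) ltnS (leq_trans (leq_addr b a)).
Qed.

Lemma subst_coef (I J : mon) e a b : val J = (e, a, b) ->
  (subst << I >>)@_J = pairing_mon e (X ^+ a * Y ^+ b) (val I) / (a`!%:R * b`!%:R).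
Proof.
move=> JE; have := pairing_subst1 e a b << I >>.
rewrite (pairing_mono _ JE) pairingU => <-.
by rewrite mulrC mulKf // mulf_neq0 ?fact0.
Qed.

Lemma subst_triangular : s != 0 -> triangular subst.
Proof.
move=> s0 I; have cong a b := @mono_congXM K X Y s a b X_lin Y_lin.
split.
  case IE : (val I) => [[e a] b]; rewrite (subst_coef _ IE) IE /pairing_mon /= eqxx.
  have /subr0_eq -> := cong a b a b (ltnSn _).
  by rewrite monoE !eqxx /= !mulf_neq0 ?invr_eq0 ?mulf_neq0 ?expf_neq0 ?fact0.
move=> J; case JE : (val J) => [[e a] b]; rewrite (subst_coef _ JE).
case IE : (val I) => [[i p] q]; rewrite /pairing_mon /=.
have [ie|_] := eqVneq i e; last by rewrite mul0r eqxx.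
have [lt _|ge] := ltnP (a + b) (p + q).
  by right; rewrite /modd /mdegree /= ie -!addnA ltn_add2l.
have /subr0_eq -> := cong a b p q ge.
rewrite monoE; case: (boolP (_ && _)) => [/andP[/eqP pa /eqP qb] _|_]; last first.
  by rewrite mulr0 mul0r eqxx.
by left; apply: val_inj; rewrite IE JE ie pa qb.
Qed.

Lemma pairing_subst e u a b x :
  pairing e (mono u a b) (subst x) = pairing e (mono u 0 0 * (X ^+ a * Y ^+ b)) x.
Proof.
rewrite -[u in LHS]mulr1 -[a in LHS]add0n -[b in LHS]add0n -monoM.
by rewrite !pairingZ pairing_subst1.
Qed.

Lemma pairing2_tensmap_subst e a b e' a' b' (z : SW2) :
  pairing2 e (mono 1 a b) e' (mono 1 a' b') (tensmap false subst subst z) =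
  pairing2 e (X ^+ a * Y ^+ b) e' (X ^+ a' * Y ^+ b') z.
Proof.
apply: (eq_linear_malg
  (f := pairing2 e (mono 1 a b) e' (mono 1 a' b') \o tensmap false subst subst)
  (g := pairing2 e (X ^+ a * Y ^+ b) e' (X ^+ a' * Y ^+ b'))) => -[I J].
by rewrite /= tensmapU pairing2_tens !pairing_subst1 !pairingU pairing2U.
Qed.

(** Dual to the multiplicativity of substitution: the images of two monomials multiply to the image
    of their product. *)
Lemma Delta_subst x : Delta (subst x) = tensmap false subst subst (Delta x).
Proof.
apply: (pairing2_ext charK0) => e a b e' a' b' ab ab'.
have mono00 i j k : (i = 0%N -> 0 < j + k)%N -> i = 0%N -> mono 1 j k 0%N 0%N = 0 :> K.
  by move=> jk /jk; rewrite monoE; case: j k {jk} => [|j] [|k].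
have XY00 i j k : (i = 0%N -> 0 < j + k)%N -> i = 0%N ->
    (X ^+ j * Y ^+ k) 0%N 0%N = 0.
  by move=> jk /jk; exact: (@ordge_XY j k 0%N 0%N).
rewrite pairing2_tensmap_subst !pairing2_Delta;
  [|exact: XY00|exact: XY00|exact: mono00|exact: mono00].
by rewrite monoM mulr1 pairing_subst1 !exprD mulrACA.
Qed.

End Substitution.

(** * Conjugacy from a change of coordinates *)

Section Equivalence.
Variable K : fieldType.
Hypothesis charK0 : [pchar K] =i pred0.
Local Notation P := (fps (fps K)).
Local Notation SW := (SymW K).
Local Notation W := (Wsp K).

Lemma mono_mul_natr (u : K) n a b : mono (u * n%:R) a b = mono u a b * n%:R.
Proof.
rewrite !mulr_natr; elim: n => [|n IH]; first by rewrite !mulr0n mono0.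
by rewrite !mulrS monoD IH.
Qed.

(** In the coordinates [X], [Y] the vector field of [d] looks like that of [d'] in [x], [y]. Hence
    the transposed substitution [h] satisfies [coder d' h = h coder d], and the automorphism sought
    is its inverse. *)
Lemma equivalent_of_coordinates (d d' : {linear SW -> W}) (X Y : P) (s c a : K) m :
  homL true d -> homL true d' ->
  component_series d 0 i1 = 0 -> component_series d' 0 i1 = 0 ->
  component_series d' 1 i2 = mono 1 1 0 + mono a 0 m ->
  component_series d' 1 i3 = mono c 0 1 ->
  s != 0 -> ordge 2 (X - mono s 1 0) -> ordge 2 (Y - mono 1 0 1) ->
  vfield (component_series d 1 i2) (component_series d 1 i3) X =
    X + mono a 0 0 * Y ^+ m ->
  vfield (component_series d 1 i2) (component_series d 1 i3) Y = mono c 0 0 * Y ->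
  equivalent d d'.
Proof.
move=> d_odd d'_odd dE d'E d'A d'B s0 X_lin Y_lin vX vY.
have [h [h_tri h_Delta hP]] : exists h : {linear SW -> SW},
    [/\ triangular h, forall x, Delta (h x) = tensmap false h h (Delta x) &
      forall e u p q x, pairing e (mono u p q) (h x) =
        pairing e (mono u 0 0 * (X ^+ p * Y ^+ q)) x].
  exists (subst X Y); split.
  - exact: subst_triangular s0.
  - exact: Delta_subst X_lin Y_lin.
  - exact: pairing_subst X_lin Y_lin.
have [g g_tri [hg gh]] := triangular_bijective h_tri.
have intertwine x : coder d' (h x) = h (coder d x).
  apply: (pairing_ext charK0) => e p q.
  have [e_ge2|e_le1] := ltnP 1 e.
    have pairing_ge2 F y : pairing e F y = 0.
      rewrite pairingE big1 // => I _; rewrite /pairing_mon.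
      have /andP[I1 _] := valP I; rewrite ltn_eqF ?mulr0 //.
      exact: leq_ltn_trans e_ge2.
    by rewrite !pairing_ge2.
  have [->|->] : e = 1%N \/ e = 0%N by case: e e_le1 => [|[|//]] _; [right|left].
    rewrite [RHS]hP (pairing_coder1 charK0 d'_odd _ (h x)).
    rewrite (pairing_coder1 charK0 d_odd _ x) dE d'E !mul0r.
    by rewrite !pairing0.
  rewrite [RHS]hP mono1 mul1r (pairing_coder0 charK0 d'_odd _ (h x)).
  rewrite (pairing_coder0 charK0 d_odd _ x) d'A d'B vfieldM !vfieldX vX vY.
  rewrite /vfield dx_mono dy_mono mulrDl !monoM !add0n !add1n !mul1r.
  rewrite !pairingD !hP -!pairingD.
  have -> : mono p%:R 0 0 = p%:R :> P.
    by rewrite -[p%:R in LHS]mul1r mono_mul_natr mono1 mul1r.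
  rewrite !mono_mul_natr !exprS exprD -!(mulr_natr (X ^+ _ * _)).
  rewrite -(mulr_natr (Y ^+ _ * _)); congr (pairing _ _ _).
  by ring.
exists g, h; split=> [|x]; last by rewrite -{1}(gh x) intertwine.
split=> [|||x]; [exact: gh|exact: hg|exact: triangular_homS|].
have := h_Delta (g x); rewrite gh => ->.
by rewrite (tensmap_cancel hg).
Qed.
End Equivalence.

(** * Extensions of the linear codifferential *)

Section Extensions.
Variable K : fieldType.
Hypothesis charK0 : [pchar K] =i pred0.
Local Notation P := (fps (fps K)).
Local Notation SW := (SymW K).
Local Notation W := (Wsp K).
Let fact0 := fact_neq0 charK0.

Lemma phi_w I J (j : 'I_3) : is_mon J ->
  phi K I j (w K J) = if J == I then (mfact I)%:R *: gen K j else 0.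
Proof. by move=> JP; rewrite (wE _ JP) /phi /= linextU. Qed.

(** The factor [I!] in [phi] cancels the normalization of [component_series], leaving a monomial
    with coefficient 1. *)
Lemma component_series_phi e0 a b (j : 'I_3) e (k : 'I_3) :
  is_mon (e0, a, b) ->
  component_series (phi K (e0, a, b) j) e k =
  if (e == e0) && (k == j) then mono 1 a b else 0.
Proof.
move=> IP; apply: fps2P => p q; rewrite /component_series.
have [JP|JP] := boolP (is_mon (e, p, q)); last first.
  rewrite w_out // linear0 mxE mul0r; case: ifP => [/andP[/eqP ee _]|] //.
  rewrite monoE; case: ifP => [/andP[/eqP pa /eqP qb]|] //.
  by rewrite ee pa qb IP in JP.
rewrite phi_w // !xpair_eqE; case: (eqVneq e e0) => [ee|_] /=; last first.
  by rewrite mxE mul0r.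
rewrite -[RHS]/((if k == j then mono 1 a b else 0 : P) p q).
case: andP => [[/eqP -> /eqP ->]|npq].
  rewrite /mfact /= !mxE eqxx /=; case: (eqVneq k j) => [_|_]; last first.
    by rewrite mulr0 mul0r.
  have e01 : e0`! = 1%N by case: e0 IP {ee} => [|[|]].
  by rewrite monoE !eqxx e01 mul1n natrM mulr1 divff // mulf_neq0 ?fact0.
rewrite mxE mul0r; case: ifP => // _; rewrite monoE.
by case: andP => // pq; case: npq.
Qed.

Lemma component_seriesD (f g : SW -> W) e j :
  component_series (f \+ g) e j = component_series f e j + component_series g e j.
Proof.
by apply: fps2P => p q; rewrite !fpsDE /component_series mxE mulrDl.
Qed.

Lemma component_seriesZ (c : K) (f : SW -> W) e j :
  component_series (c \*: f) e j = mono c 0 0 * component_series f e j.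
Proof.
by apply: fps2P => p q; rewrite monoME /= !subn0 /component_series mxE mulrA.
Qed.

Lemma component_series_dc (c : K) e j :
  component_series (d_c c) e j =
  if e == 1%N then
    if j == i2 then mono 1 1 0 else if j == i3 then mono c 0 1 else 0
  else 0.
Proof.
rewrite [LHS]component_seriesD component_seriesZ !component_series_phi //.
case: (e == 1%N) => /=; last by rewrite mulr0 addr0.
have [->|_] := eqVneq j i2; first by rewrite mulr0 addr0.
by case: (j == i3); rewrite ?mulr0 add0r // monoM mulr1.
Qed.

Lemma component_series_de (c : K) m e j :
  component_series (d_e c m) e j = component_series (d_c c) e j +
    if (e == 1%N) && (j == i2) then mono 1 0 m else 0.
Proof. by rewrite [LHS]component_seriesD component_series_phi. Qed.

Lemma homL_phi I (j : 'I_3) : godd j = ~~ modd I -> homL true (phi K I j).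
Proof.
move=> jI J k; rewrite /phi /= linextU; have [->|_] := eqVneq (sval J) I; last first.
  by rewrite mxE eqxx.
rewrite !mxE /= addbT -jI; case: (eqVneq k j) => [->|] //=.
by rewrite mulr0 eqxx.
Qed.

Lemma homLD p (f g : SW -> W) : homL p f -> homL p g -> homL p (f \+ g).
Proof.
move=> fp gp I j /=; rewrite mxE => fg.
have [f0|/eqP/eqP/fp//] := eqVneq (f << I >> 0 j) 0.
by apply: gp; apply: contraNneq fg => ->; rewrite f0 addr0.
Qed.

Lemma homLZ p (c : K) (f : SW -> W) : homL p f -> homL p (c \*: f).
Proof.
by move=> fp I j /=; rewrite mxE mulf_eq0 negb_or => /andP[_ /fp].
Qed.

Lemma homL_dc (c : K) : homL true (d_c c).
Proof. by apply: homLD; [|apply: homLZ]; apply: homL_phi. Qed.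

Lemma homL_de (c : K) m : homL true (d_e c m).
Proof. by apply: homLD; [exact: homL_dc|exact: homL_phi]. Qed.

Lemma component_w n (d : {linear SW -> W}) I : is_mon I ->
  component n d (w K I) = if mdegree I == n then d (w K I) else 0.
Proof. by move=> IP; rewrite (wE _ IP) /component linextU. Qed.

(** The shift by [e] arises because [w_1] counts towards the degree in L but not towards the order
    of the series in [x], [y]. *)
Lemma component_series_congr n (d d' : {linear SW -> W}) e j :
  (forall k, (k <= n)%N -> component k d =1 component k d') ->
  ordge (n.+1 - e) (component_series d e j - component_series d' e j).
Proof.
move=> dd' p q; rewrite ltn_subRL addnA => pq.
rewrite fpsDE fpsNE fpsDE fpsNE; apply/eqP; rewrite subr_eq0 /component_series.
have [IP|IP] := boolP (is_mon (e, p, q)); last by rewrite w_out // !linear0.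
have := dd' (e + p + q)%N pq (w K (e, p, q)).
by rewrite !component_w // /mdegree eqxx => ->.
Qed.

Lemma dc_mon (c : K) (I : mon) : mdegree (val I) != 2 -> d_c c << I >> = 0.
Proof.
move=> I2; rewrite -w_val /d_c /= -![linext _ _]/(phi K _ _ _) !phi_w ?(valP I) //.
have [I110|_] := eqVneq (val I) (1, 1, 0)%N; first by rewrite I110 in I2.
have [I101|_] := eqVneq (val I) (1, 0, 1)%N; first by rewrite I101 in I2.
by rewrite scaler0 addr0.
Qed.

(** The index [N] hidden in [leading_term] must be 2, because [d_c] is nonzero on [w_1 w_2]. *)
Lemma extension_dc_components (c : K) (d : {linear SW -> W}) :
  leading_term d (d_c c) ->
  forall k, (k <= 2)%N -> component k d =1 component k (d_c c).
Proof.
move=> [N [dlow dN _]].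
have dc110 : d_c c (w K (1, 1, 0)%N) != 0.
  apply/eqP => /rowP /(_ i2); rewrite /d_c /= !mxE.
  rewrite -![linext _ _]/(phi K _ _ _) !phi_w //= !mxE /= !mulr0.
  by rewrite addr0 mulr1 => /eqP; rewrite oner_eq0.
have N2 : N = 2.
  apply/eqP; apply: contraNT dc110 => N2; rewrite -dN component_w //.
  by rewrite (eq_sym (mdegree _)) (negPf N2).
rewrite {}N2 {N dc110} in dlow dN *; move=> k; rewrite leq_eqVlt.
case/predU1P=> [->|lt_k2] x.
  rewrite dN linear_malgE; apply: eq_bigr => I _.
  by case: eqVneq => // /dc_mon ->.
rewrite (dlow k lt_k2) /component /linext big1 // => I _.
by case: eqVneq => [Ik|_]; rewrite ?dc_mon ?scaler0 // Ik ltn_eqF.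
Qed.

Variables (m : nat) (m_gt1 : (1 < m)%N).
Local Notation c := (m%:R^-1 : K).

(** The series [X], [Y] and the equation for [X] are kept in the conclusion so that [a] can be
    computed for extensions of d_e. *)
Lemma resonant_normal_form (d : {linear SW -> W}) :
  codifferential d ->
  ordge 2 (component_series d 1 i2 - mono 1 1 0) ->
  ordge 2 (component_series d 1 i3 - mono c 0 1) ->
  exists (X Y : P) (a : K),
    [/\ ordge 2 (X - mono 1 1 0), ordge 2 (Y - mono 1 0 1),
        vfield (component_series d 1 i2) (component_series d 1 i3) X =
          X + mono a 0 0 * Y ^+ m,
        a = 0 -> equivalent d (d_c c) & a != 0 -> equivalent d (d_e c m)].
Proof.
move=> d_codiff A_lin B_lin.
have d_odd : homL true d := d_codiff.1.
have dE : component_series d 0 i1 = 0.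
  apply: (codifferential_series0 charK0 d_odd d_codiff).
  apply/eqP => A0; have := A_lin 1%N 0%N isT.
  rewrite A0 !fpsDE !fpsNE monoE /= sub0r => /eqP.
  by rewrite oppr_eq0 oner_eq0.
have [Y [Y_lin vY]] := normal_coordinate_y charK0 m_gt1 A_lin B_lin.
have [X [a [X_lin vX]]] := normal_coordinate_x charK0 m_gt1 A_lin B_lin Y_lin.
exists X, Y, a; split=> // [a0|a0].
  apply: (equivalent_of_coordinates charK0 d_odd (@homL_dc c) dE (X := X) (Y := Y)
    (s := 1) (a := 0) (m := m) (c := c)); rewrite ?component_series_dc ?oner_neq0 //.
    by rewrite mono0 addr0.
  by rewrite vX a0.
apply: (equivalent_of_coordinates charK0 d_odd (@homL_de c m) dE
  (X := mono a^-1 0 0 * X) (Y := Y) (s := a^-1) (a := 1) (m := m) (c := c));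
  rewrite ?component_series_de ?component_series_dc ?invr_neq0 ?addr0 //.
  have -> : mono a^-1 0 0 * X - mono a^-1 1 0 = mono a^-1 0 0 * (X - mono 1 1 0).
    by rewrite mulrBr monoM mulr1.
  exact: (ordgeM (@ordge_mono _ a^-1 0 0) X_lin).
have v_scale u : vfield (component_series d 1 i2) (component_series d 1 i3)
    (mono u 0 0) = 0.
  by rewrite /vfield dx_mono dy_mono !mulr0n !mono0 !mulr0 addr0.
by rewrite vfieldM v_scale mul0r add0r vX mulrDr mulrA monoM mulVf // mono1.
Qed.

(* The coefficient of [y^m] of [v X = X + a Y^m]: the diagonal part contributes
   [c m X_(0,m) = X_(0,m)] to the left side and [y^m dx] contributes [1]. *)
Lemma resonant_coefficient1 (A B X Y : P) (a : K) :
  ordge m.+1 (A - (mono 1 1 0 + mono 1 0 m)) -> ordge m.+1 (B - mono c 0 1) ->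
  ordge 2 (X - mono 1 1 0) -> ordge 2 (Y - mono 1 0 1) ->
  vfield A B X = X + mono a 0 0 * Y ^+ m -> a = 1.
Proof.
move=> A_high B_high X_lin Y_lin vX.
have -> : a = vfield A B X 0%N m - X 0%N m.
  have := @ordge_congX K Y 1 0 1 m Y_lin 0%N m.
  rewrite muln0 muln1 add0n expr1n ltnSn => /(_ isT)/subr0_eq Ym.
  rewrite vX fpsDE fpsDE monoME /= !subn0 Ym monoE !eqxx mulr1.
  by rewrite addrAC subrr add0r.
have -> : vfield A B X = mono 1 1 0 * dx X + mono 1 0 m * dx X + mono c 0 1 * dy X +
    ((A - (mono 1 1 0 + mono 1 0 m)) * dx X + (B - mono c 0 1) * dy X).
  by rewrite /vfield; ring.
have rest0 : ((A - (mono 1 1 0 + mono 1 0 m)) * dx X + (B - mono c 0 1) * dy X) 0%N m = 0.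
  have ordge0 (f : P) : ordge 0 f by [].
  have := ordgeD (ordgeM A_high (ordge0 (dx X))) (ordgeM B_high (ordge0 (dy X))).
  by rewrite addn0; apply.
have X10 : X 1%N 0%N = 1 by have /subr0_eq -> := X_lin 1%N 0%N isT; rewrite monoE.
rewrite fpsDE fpsDE rest0 addr0 !fpsDE !monoME (ltnW m_gt1) /= leqnn !subnn subn1.
rewrite dxE dyE X10 prednK ?(ltnW m_gt1) // mulr1n -(mulr_natl (X _ _)).
by rewrite mulKf ?natr_m_neq0 // add0r mul1r addrK.
Qed.

End Extensions.

Theorem mainTheorem3 (R : realType) (m : nat) (hm : (2 < m)%N) :
  let c : R[i] := (m%:R)^-1 in
  (forall d : {linear SymW R[i] -> Wsp R[i]},
     extension (d_c c) d -> ~ equivalent d (d_c c) -> equivalent d (d_e c m)) /\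
  (forall d : {linear SymW R[i] -> Wsp R[i]},
     higher_extension m.+1 (d_e c m) d -> equivalent d (d_e c m)).
Proof.
move=> c.
have charK0 : [pchar R[i]] =i pred0 := @Num.Theory.pchar_num R[i].
have m_gt1 : (1 < m)%N := ltnW hm.
split=> d [d_codiff dd].
  have low := extension_dc_components dd.
  have low_series j := @component_series_congr _ 2 d (d_c c) 1 j low.
  have A_lin := low_series i2; have B_lin := low_series i3.
  rewrite !(component_series_dc charK0) in A_lin B_lin.
  have [X [Y [a [_ _ _ a0 an0]]]] :=
    resonant_normal_form charK0 m_gt1 d_codiff A_lin B_lin.
  move=> not_dc; have [a_eq0|a_neq0] := eqVneq a 0; last exact: an0 a_neq0.
  by case: not_dc; apply: a0 a_eq0.
have high_series j := @component_series_congr _ m.+1 d (d_e c m) 1 j dd.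
have A_high : ordge m.+1 (component_series d 1 i2 - (mono 1 1 0 + mono 1 0 m)).
  have := high_series i2.
  by rewrite (component_series_de charK0) (component_series_dc charK0) subn1.
have B_high : ordge m.+1 (component_series d 1 i3 - mono c 0 1).
  have := high_series i3.
  rewrite (component_series_de charK0) (component_series_dc charK0) subn1.
  by rewrite [X in _ + X]/= addr0.
have A_lin : ordge 2 (component_series d 1 i2 - mono 1 1 0).
  have -> : component_series d 1 i2 - mono 1 1 0 =
      component_series d 1 i2 - (mono 1 1 0 + mono 1 0 m) + mono 1 0 m.
    by rewrite opprD addrA subrK.
  (* The resonant term [y^m] has order at least 2, so d_e and d_c have the same linear part. *)
  apply: ordgeD; first exact: ordge_leq (leqW m_gt1) A_high.
  exact: ordge_leq m_gt1 (@ordge_mono _ 1 0 m).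
have B_lin : ordge 2 (component_series d 1 i3 - mono c 0 1) :=
  ordge_leq (leqW m_gt1) B_high.
have [X [Y [a [X_lin Y_lin vX _ an0]]]] :=
  resonant_normal_form charK0 m_gt1 d_codiff A_lin B_lin.
apply: an0; rewrite (resonant_coefficient1 charK0 m_gt1 A_high B_high X_lin Y_lin vX).
exact: oner_neq0.
Qed.
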